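(* Let $G^{(1)},G^{(2)}\in\mathbb{R}^{N\times N}$ be symmetric matrices with zero diagonals (undirected layers), let $\kappa\in[0,1]$, and suppose the multiplex network game is a game of strategic complements, i.e., all entries of $G^{\parallel}=\kappa G^{(1)}+(1-\kappa)G^{(2)}$ are $\leq0$. If $$|\kappa\lambda_{\min}(G^{(1)})+(1-\kappa)\lambda_{\min}(G^{(2)})|<1,$$ then at least one Nash equilibrium of the multiplex network game exists (for all admissible benefit functions and unit costs).
   Context: $\lambda_{\min}$ denotes the smallest eigenvalue of a symmetric matrix. Multiplex network game: there are $N$ agents; agent $i$ chooses an effort $x_i\in\mathbb{R}_{\geq 0}$. The two layers are given by real $N\times N$ matrices $G^{(1)}=(g^{(1)}_{ij})$ and $G^{(2)}=(g^{(2)}_{ij})$ with zero diagonals, and $\kappa\in[0,1]$. Agent $i$'s utility is $$u_i(\mathbf{x})=b_i\Bigl(x_i+\kappa\sum_{j=1}^N g^{(1)}_{ij}x_j+(1-\kappa)\sum_{j=1}^N g^{(2)}_{ij}x_j\Bigr)-c_ix_i,$$ where the benefit function $b_i:\mathbb{R}\to\mathbb{R}$ is twice differentiable, strictly increasing and strictly concave, and the unit cost is $c_i>0$; it is assumed that there is a (necessarily unique) $q_i\in\mathbb{R}$ with $b_i'(q_i)=c_i$ (this is what ''admissible'' means). A (pure) Nash equilibrium is a vector $\mathbf{x}^*\in\mathbb{R}^N_{\geq 0}$ such that each $x_i^*$ maximizes $u_i$ over $x_i\ge 0$ given the others; equivalently, $x_i^*=\max\{0,\,q_i-(G^{\parallel}\mathbf{x}^*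 )_i\}$ for all $i$. *)

(* Defs.v *)
From mathcomp Require Import all_boot all_order all_algebra.
From mathcomp Require Import polyrcf complex.
From mathcomp Require Import boolp classical_sets reals topology normedtype derive.

Set Implicit Arguments.
Unset Strict Implicit.
Unset Printing Implicit Defensive.

Import Order.TTheory GRing.Theory Num.Theory.
Import numFieldNormedType.Exports.

Local Open Scope classical_set_scope.
Local Open Scope ring_scope.

(* For a symmetric matrix of positive dimension the infimum is a minimum, by
   [lambda_minP] below; for N = 0 there is no eigenvalue and its value is 0. *)
Definition lambda_min (R : realType) (N : nat) (A : 'M[R]_N) : R :=
  inf [set a | eigenvalue A a].

Lemma seq_minP (R : realType) (s : seq R) :
  s != [::] -> exists2 m, m \in s & forall a, a \in s -> m <= a.
Proof.
elim: s => // x [|y s] IHs _.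
  by exists x => [|a]; rewrite inE // => /eqP ->.
have [//|m ms mP] := IHs.
have [xm|mx] := leP x m.
- exists x; first by rewrite inE eqxx.
  by move=> a; rewrite inE => /predU1P[-> //|/mP]; exact: le_trans.
- exists m; first by rewrite inE ms orbT.
  by move=> a; rewrite inE => /predU1P[-> |/mP //]; exact: ltW.
Qed.

Lemma symmetric_has_eigenvalue (R : realType) (N : nat) (A : 'M[R]_N) :
  (0 < N)%N -> A^T = A -> exists a, eigenvalue A a.
Proof.
case: N A => // N A _ symA.
pose B := map_mx (real_complex R) A.
have Bherm : B \is hermsymmx.
  apply: realsym_hermsym.
  - apply/is_hermitianmxP; rewrite expr0 scale1r map_mx_id //.
    by apply/matrixP => i j; rewrite !mxE -[in LHS]symA mxE.
  - by apply/mxOverP => i j; rewrite mxE; apply/complex_realP; exists (A i j).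
have /orthomx_spectralP B_eq := hermitian_normalmx Bherm.
have /mxOverP/(_ ord0 ord0) /complex_realP[a aE] :=
  hermitian_spectral_diag_real Bherm.
exists a; rewrite eigenvalue_root_char -(fmorph_root (real_complex R)).
rewrite map_char_poly -/B.
suff : eigenvalue B (spectral_diag B ord0 ord0).
  by rewrite eigenvalue_root_char aE.
have Pu := spectral_unit B.
apply/eigenvalueP; exists (row ord0 (spectralmx B)); last first.
  rewrite -row_free_unit in Pu; apply: contraTneq Pu => r0.
  by apply/row_freePn; exists ord0; rewrite r0 sub0mx.
rewrite {2}B_eq -row_mul !mulmxA mulmxV // mul1mx.
by apply/rowP => j; rewrite mul_diag_mx !mxE.
Qed.

Lemma lambda_minP (R : realType) (N : nat) (A : 'M[R]_N) :
  (0 < N)%N -> A^T = A ->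
  eigenvalue A (lambda_min A) /\
  (forall a, eigenvalue A a -> lambda_min A <= a).
Proof.
move=> N0 symA; have [a aA] := symmetric_has_eigenvalue N0 symA.
pose s := rootsR (char_poly A).
have sE x : eigenvalue A x = (x \in s).
  rewrite eigenvalue_root_char.
  by have /roots_onP -> := roots_on_rootsR (monic_neq0 (char_poly_monic A)).
have [|m ms mP] := @seq_minP R s; first by apply: contraTneq aA; rewrite sE => ->.
have lbm : lbound [set a | eigenvalue A a] m by move=> x /=; rewrite sE; exact: mP.
suff -> : lambda_min A = m by split => [|x]; rewrite sE //; exact: mP.
apply/le_anti/andP; split.
- by apply: ge_inf; [exists m | rewrite /= sE].
- by apply: lb_le_inf => //; exists a.
Qed.

Definition twice_differentiable (R : realType) (f : R -> R) : Prop :=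
  (forall x : R, derivable f x 1) /\ (forall x : R, derivable (derive1 f) x 1).

Definition strictly_concave (R : realType) (f : R -> R) : Prop :=
  forall x y t : R, x != y -> 0 < t < 1 ->
    t * f x + (1 - t) * f y < f (t * x + (1 - t) * y).

Definition admissible (R : realType) (f : R -> R) (cost : R) : Prop :=
  [/\ twice_differentiable f,
      {homo f : x y / x < y},
      strictly_concave f,
      0 < cost
    & exists q : R, derive1 f q = cost].

Definition multiplex (R : realType) (N : nat) (G1 G2 : 'M[R]_N) (kappa : R)
    : 'M[R]_N :=
  kappa *: G1 + (1 - kappa) *: G2.

Definition utility (R : realType) (N : nat) (G1 G2 : 'M[R]_N) (kappa : R)
    (b : 'I_N -> R -> R) (c : 'I_N -> R) (i : 'I_N) (x : 'cV[R]_N) : R :=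
  b i (x i 0 + kappa * (\sum_(j < N) G1 i j * x j 0)
             + (1 - kappa) * (\sum_(j < N) G2 i j * x j 0))
  - c i * x i 0.

Definition deviate (R : realType) (N : nat) (x : 'cV[R]_N) (i : 'I_N) (y : R)
    : 'cV[R]_N :=
  \col_j (if j == i then y else x j 0).

Definition nash_equilibrium (R : realType) (N : nat) (G1 G2 : 'M[R]_N)
    (kappa : R) (b : 'I_N -> R -> R) (c : 'I_N -> R) (x : 'cV[R]_N) : Prop :=
  (forall i : 'I_N, 0 <= x i 0) /\
  (forall (i : 'I_N) (y : R), 0 <= y ->
     utility G1 G2 kappa b c i (deviate x i y)
       <= utility G1 G2 kappa b c i x).

(* Main.v *)
(* By Rayleigh's inequality in each layer, [m |y|^2 <= y G y^T] with
   [m = kappa * lambda_min G1 + (1 - kappa) * lambda_min G2 > -1]. A nonnegative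
   [y] below its own best response satisfies [y_i^2 <= y_i (q_i - (G y)_i)],
   hence [(1 + m) |y|^2 <= y . q], so all such [y] lie in a bounded set. Since
   the entries of [G] are nonpositive the best response is monotone, and the
   pointwise supremum of these [y] is a fixed point (Knaster-Tarski). *)
Require Import Defs.
From mathcomp Require Import all_boot all_order all_algebra.
From mathcomp Require Import complex ring lra.
From mathcomp Require Import boolp classical_sets reals topology normedtype derive.

Import Order.TTheory GRing.Theory Num.Theory.
Import numFieldNormedType.Exports.

Local Open Scope ring_scope.

(** Over the complex numbers [A] becomes Hermitian, hence unitarily diagonalizable with real
    diagonal. Row [k] of the unitary matrix is a left eigenvector for the [k]-th diagonal entry, and
    that eigenvalue descends to [A] because the embedding of the reals preserves and reflects roots
    of the characteristic polynomial. *)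
Lemma symmetric_spectral (R : realType) (N : nat) (A : 'M[R]_N)
    (B := map_mx (real_complex R) A) :
  A^T = A ->
  B = invmx (spectralmx B) *m diag_mx (spectral_diag B) *m spectralmx B /\
  forall k, exists2 a, eigenvalue A a & spectral_diag B 0 k = real_complex R a.
Proof.
move=> symA.
have Bherm : B \is hermsymmx.
  apply: realsym_hermsym.
  - apply/is_hermitianmxP; rewrite expr0 scale1r map_mx_id //.
    by apply/matrixP => i j; rewrite !mxE -[in LHS]symA mxE.
  - by apply/mxOverP => i j; rewrite mxE; apply/complex_realP; exists (A i j).
have /orthomx_spectralP B_eq := hermitian_normalmx Bherm.
split=> // k.
have /mxOverP/(_ ord0 k) /complex_realP[a aE] :=
  hermitian_spectral_diag_real Bherm.
exists a => //; rewrite eigenvalue_root_char -(fmorph_root (real_complex R)).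
rewrite map_char_poly -/B.
suff : eigenvalue B (spectral_diag B 0 k) by rewrite eigenvalue_root_char aE.
have Pu := spectral_unit B.
apply/eigenvalueP; exists (row k (spectralmx B)); last first.
  rewrite -row_free_unit in Pu; apply: contraTneq Pu => r0.
  by apply/row_freePn; exists k; rewrite r0 sub0mx.
rewrite {2}B_eq -row_mul !mulmxA mulmxV // mul1mx.
by apply/rowP => j; rewrite mul_diag_mx !mxE.
Qed.

(** In the coordinates [w] of [v] along the orthonormal eigenbasis, both sides are sums of
    [|w_k|^2], weighted by [lambda_min A] on the left and by the eigenvalues on the right. *)
Lemma rayleigh_lambda_min (R : realType) (N : nat) (A : 'M[R]_N) (v : 'rV[R]_N) :
  A^T = A -> lambda_min A * (v *m v^T) 0 0 <= (v *m A *m v^T) 0 0.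
Proof.
case: N A v => [|N] A v symA; first by rewrite (thinmx0 v) !mul0mx mxE mulr0.
have [_ lbA] := @lambda_minP R N.+1 A isT symA.
have [] := @symmetric_spectral R N.+1 A symA.
set B := map_mx _ A; set P := spectralmx B; set D := spectral_diag B.
have Pu : P \is unitarymx := spectral_unitarymx B.
rewrite (invmx_unitary Pu) => B_eq D_eig.
pose vc := map_mx (real_complex R) v.
pose w := vc *m map_mx Num.conj P^T.
(* Since [v] is real, conjugation fixes it and only acts on [P]. *)
have wE : map_mx Num.conj w^T = P *m vc^T.
  rewrite /w trmx_mul map_mxM -map_trmx trmxK.
  congr (_ *m _); first by apply/matrixP => i j; rewrite !mxE; exact: conjCK.
  apply/matrixP => i j; rewrite !mxE.
  by apply/CrealP/complex_realP; exists (v j i).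
have sqE : real_complex R ((v *m v^T) 0 0) = \sum_k `|w 0 k| ^+ 2.
  transitivity ((w *m map_mx Num.conj w^T) 0 0).
    rewrite wE /w mulmxA -(mulmxA vc).
    have -> : map_mx Num.conj P^T *m P = 1%:M.
      by rewrite -(invmx_unitary Pu) mulVmx // unitarymx_unit.
    by rewrite mulmx1 /vc map_trmx -(map_mxM (real_complex R)) [RHS]mxE.
  rewrite mxE; apply: eq_bigr => k _.
  by rewrite [X in _ * X]mxE [w^T _ _]mxE normCK.
have quadE : real_complex R ((v *m A *m v^T) 0 0) =
    \sum_k D 0 k * `|w 0 k| ^+ 2.
  transitivity ((w *m diag_mx D *m map_mx Num.conj w^T) 0 0).
    rewrite wE /w; transitivity ((vc *m B *m vc^T) 0 0).
      by rewrite /vc /B map_trmx -!(map_mxM (real_complex R)) [RHS]mxE.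
    by rewrite B_eq !mulmxA.
  rewrite mxE; apply: eq_bigr => k _.
  by rewrite mul_mx_diag [X in _ * X]mxE [w^T _ _]mxE [X in X * _]mxE normCK mulrCA mulrA.
rewrite -lecR quadE rmorphM /= sqE mulr_sumr; apply: ler_sum => k _.
have [a /lbA aA ->] := D_eig k.
by rewrite ler_wpM2r ?exprn_ge0 ?normr_ge0 // lecR.
Qed.

(** Concavity bounds the difference quotient at [q] in direction [x - q] below by [f x - f q] for
    every step [h] in (0, 1); letting [h] tend to 0 from the right gives the derivative. *)
Lemma strictly_concave_tangent (R : realType) (f : R -> R) (q x : R) :
  derivable f q 1 -> strictly_concave f ->
  f x <= f q + derive1 f q * (x - q).
Proof.
move=> fq fconc; have [->|xq] := eqVneq x q; first by rewrite subrr mulr0 addr0.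
have df : differentiable f q by apply/derivable1_diffP.
rewrite addrC -lerBlDr.
have -> : derive1 f q * (x - q) = 'D_(x - q) f q.
  rewrite derive1E' // deriveE // mulrC.
  have := linearZ_LR ('d f q) (x - q) (1 : R).
  by rewrite /GRing.scale /= mulr1 => ->.
have dx : derivable f q (x - q) by apply: diff_derivable.
have cvg_r : ((fun h : R => h^-1 *: (f (h *: (x - q) + q) - f q)) @ 0^'+
    --> 'D_(x - q) f q)%classic.
  by apply: cvg_dnbhs_at_right.
apply: (cvgr_to_ge cvg_r); near=> h.
have h0 : 0 < h by near: h; exact: nbhs_right_gt.
have h1 : h < 1 by near: h; exact: nbhs_right_lt.
rewrite /GRing.scale /= ler_pdivlMl //.
have := fconc x q h xq; rewrite h0 h1 => /(_ isT).
rewrite (_ : h * x + (1 - h) * q = h * (x - q) + q); last by ring.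
by move=> ?; lra.
Unshelve. all: by end_near.
Qed.

(** Here [z] is the agent's own effort, [s] the contribution of the others, and the unit cost is the
    slope of [f] at [q]. If [s <= q], the best response brings the argument of [f] to [q], and the
    tangent at [q] concludes. Otherwise [s] lies between [q] and [z + s], and concavity on that
    segment is combined with the tangent. *)
Lemma best_response_max (R : realType) (f : R -> R) (q s z : R) :
  derivable f q 1 -> strictly_concave f -> 0 <= z ->
  f (z + s) - derive1 f q * z <=
    f (Num.max 0 (q - s) + s) - derive1 f q * Num.max 0 (q - s).
Proof.
move=> fq fconc z0.
have [qs|sq] := leP 0 (q - s).
  have := @strictly_concave_tangent R f q (z + s) fq fconc.
  by rewrite subrK => ?; lra.
rewrite add0r mulr0 subr0.
have [->|zn0] := eqVneq z 0; first by rewrite add0r mulr0 subr0.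
have zp : 0 < z by rewrite lt_neqAle eq_sym zn0.
(* This weight makes [s] the convex combination of [z + s] and [q]. *)
pose t := (s - q) / (z + s - q).
have d0 : 0 < z + s - q by lra.
have t0 : 0 < t by rewrite divr_gt0 //; lra.
have t1 : t < 1 by rewrite ltr_pdivrMr //; lra.
have neq : z + s != q by apply/eqP; lra.
have := fconc (z + s) q t neq; rewrite t0 t1 => /(_ isT).
have -> : t * (z + s) + (1 - t) * q = s by rewrite /t; field; apply/eqP; lra.
(* The tangent inequality, scaled by [1 - t], eliminates [f q] from the concavity inequality; the
   remaining slope term is exactly the cost of [z], as [(1 - t) * (z + s - q) = z]. *)
have tangent_ge0 :
    0 <= (1 - t) * (f q + derive1 f q * (z + s - q) - f (z + s)).
  rewrite mulr_ge0 // subr_ge0; first exact: ltW.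
  exact: strictly_concave_tangent.
have : derive1 f q * ((1 - t) * (z + s - q)) = derive1 f q * z.
  by congr (_ * _); rewrite /t; field; apply/eqP; lra.
by move: tangent_ge0; lra.
Qed.

(** The uniform bound [M] makes the pointwise suprema finite, in place of completeness of the
    lattice. *)
Lemma knaster_tarski_pointwise (R : realType) (I : Type)
    (T : (I -> R) -> I -> R) (M : R) :
  (forall x y, (forall i, x i <= y i) -> forall i, T x i <= T y i) ->
  (exists x, forall i, x i <= T x i) ->
  (forall x, (forall i, x i <= T x i) -> forall i, x i <= M) ->
  exists x, forall i, x i = T x i.
Proof.
move=> Tmono [x0 x0T] Tbnd.
pose S i : set R := [set a | exists2 x, forall j, x j <= T x j & x i = a]%classic.
pose s i := sup (S i).
have xs x : (forall i, x i <= T x i) -> forall i, x i <= s i.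
  move=> xT i; apply: ub_le_sup; last by exists x.
  by exists M => _ [y yT <-]; exact: Tbnd.
have sT i : s i <= T s i.
  apply: ge_sup; first by exists (x0 i), x0.
  by move=> _ [x xT <-]; apply: le_trans (xT i) _; apply: Tmono; exact: xs.
exists s => i; apply/le_anti; rewrite sT /=.
(* By monotonicity [T s] also lies below its own image, so it is one of the points that [s]
   dominates. *)
by apply: xs => j; exact: Tmono.
Qed.

(** Young's inequality turns [(1 + m) |y|^2 <= y . q] into [|y|^2 <= |q|^2 / (1 + m)^2]. The summand
    1 comes from [t <= 1 + t^2], which avoids a square root. *)
Lemma best_response_bounded (R : realType) (N : nat) (G : 'M[R]_N) (m : R)
    (q y : 'I_N -> R) :
  -1 < m ->
  (forall v : 'rV[R]_N, m * (v *m v^T) 0 0 <= (v *m G *m v^T) 0 0) ->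
  (forall i, 0 <= y i) ->
  (forall i, y i <= Num.max 0 (q i - \sum_j G i j * y j)) ->
  forall i, y i <= 1 + (\sum_j q j ^+ 2) / (1 + m) ^+ 2.
Proof.
move=> m1 Gm y0 yT i.
set d := 1 + m; have d0 : 0 < d by rewrite /d; lra.
have Gy : m * (\sum_k y k ^+ 2) <= \sum_k y k * \sum_j G k j * y j.
  have := Gm (\row_k y k); rewrite -mulmxA !mxE.
  under eq_bigr do rewrite !mxE -expr2.
  under [X in _ <= X]eq_bigr do
    (rewrite !mxE; under eq_bigr do rewrite !mxE).
  by [].
have sq_le k : y k ^+ 2 <= y k * q k - y k * \sum_j G k j * y j.
  rewrite -mulrBr expr2; move: (yT k); case: (leP 0 (q k - _)) => // _ yk.
    by rewrite ler_wpM2l.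
  (* A negative [q k - (G y)_k] makes the best response 0, which forces [y k = 0]. *)
  have -> : y k = 0 by apply/le_anti; rewrite yk y0.
  by rewrite !mul0r.
(* The coefficient [d / 2] lets half of [d |y|^2] absorb the square of [y]. *)
have young k : y k * q k <= d / 2 * y k ^+ 2 + q k ^+ 2 / (2 * d).
  rewrite -subr_ge0.
  have -> : d / 2 * y k ^+ 2 + q k ^+ 2 / (2 * d) - y k * q k =
      (d * y k - q k) ^+ 2 / (2 * d) by field; lra.
  by rewrite divr_ge0 ?sqr_ge0 //; lra.
have sq_sum : \sum_k y k ^+ 2 <=
    \sum_k y k * q k - \sum_k y k * \sum_j G k j * y j.
  by rewrite -sumrB; apply: ler_sum.
have young_sum : \sum_k y k * q k <=
    d / 2 * (\sum_k y k ^+ 2) + (\sum_k q k ^+ 2) / (2 * d).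
  by rewrite mulr_sumr mulr_suml -big_split; apply: ler_sum.
have yi : y i ^+ 2 <= \sum_k y k ^+ 2.
  by rewrite (bigD1 i) //= lerDl sumr_ge0 // => k _; exact: sqr_ge0.
have bnd : \sum_k y k ^+ 2 <= (\sum_j q j ^+ 2) / d ^+ 2.
  rewrite -(ler_pM2l (_ : 0 < d / 2)); last by lra.
  have -> : d / 2 * ((\sum_j q j ^+ 2) / d ^+ 2) = (\sum_j q j ^+ 2) / (2 * d).
    by field; lra.
  by move: young_sum sq_sum Gy; rewrite /d; lra.
by nra.
Qed.

Theorem proposition10 (R : realType) (N : nat) (G1 G2 : 'M[R]_N) (kappa : R)
    (G1_sym : G1^T = G1) (G2_sym : G2^T = G2)
    (G1_diag : forall i : 'I_N, G1 i i = 0)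
    (G2_diag : forall i : 'I_N, G2 i i = 0)
    (kappa01 : 0 <= kappa <= 1)
    (complements : forall i j : 'I_N, multiplex G1 G2 kappa i j <= 0)
    (lambda_lt1 :
       `|kappa * lambda_min G1 + (1 - kappa) * lambda_min G2| < 1) :
  forall (b : 'I_N -> R -> R) (c : 'I_N -> R),
    (forall i : 'I_N, admissible (b i) (c i)) ->
    exists x : 'cV[R]_N, nash_equilibrium G1 G2 kappa b c x.
Proof.
move=> b c adm; set G := multiplex G1 G2 kappa in complements *.
have /choice[q qE] : forall i, exists q, derive1 (b i) q = c i.
  by move=> i; have [] := adm i.
pose T (y : 'I_N -> R) i := Num.max 0 (q i - \sum_j G i j * y j).
set m := kappa * _ + _ in lambda_lt1.
have m1 : -1 < m by move: lambda_lt1; rewrite ltr_norml => /andP[].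
have Gm (v : 'rV[R]_N) : m * (v *m v^T) 0 0 <= (v *m G *m v^T) 0 0.
  case/andP: kappa01 => k0 k1.
  rewrite /G /multiplex mulmxDr mulmxDl -!scalemxAr -!scalemxAl !mxE.
  have := rayleigh_lambda_min R N G1 v G1_sym.
  have := rayleigh_lambda_min R N G2 v G2_sym.
  rewrite !mxE /m mulrDl -!mulrA => h2 h1.
  by apply: lerD; rewrite ler_wpM2l ?subr_ge0.
have Tmono x y : (forall i, x i <= y i) -> forall i, T x i <= T y i.
  move=> xy i; rewrite /T ge_max !le_max lexx /= lerD2l lerN2 ler_sum ?orbT //.
  by move=> j _; rewrite ler_wnM2l.
have T0 y i : 0 <= T y i by rewrite /T le_max lexx.
have [|z zT i|x xT] := @knaster_tarski_pointwise R _ T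
    (1 + (\sum_j q j ^+ 2) / (1 + m) ^+ 2) Tmono.
- by exists (fun=> 0) => i; exact: T0.
(* The bound concerns nonnegative vectors, while [z] may have negative entries. Its positive part
   [y] still lies below [T y], because [T] is monotone with nonnegative values. *)
- pose y j := Num.max 0 (z j).
  apply: (@le_trans _ _ (y i)); first by rewrite le_max lexx orbT.
  apply: (@best_response_bounded R N G) => // j; first by rewrite le_max lexx.
  rewrite ge_max T0 /=; apply: le_trans (zT j) _; apply: Tmono => k.
  by rewrite le_max lexx orbT.
have x0 i : 0 <= x i by rewrite xT.
exists (\col_i x i); split=> [i|i y y0]; first by rewrite mxE.
have [[b1 _] _ bconc _ _] := adm i.
pose s := \sum_j G i j * x j.
(* The zero diagonals remove the agent's own effort from the network term, so [s] is the same for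
   [x] and for every deviation of agent [i]. *)
have utilE (z : 'cV[R]_N) : (forall j, j != i -> z j 0 = x j) ->
    utility G1 G2 kappa b c i z = b i (z i 0 + s) - c i * z i 0.
  move=> zx; rewrite /utility -addrA; congr (b i (_ + _) - _).
  rewrite !mulr_sumr -big_split /=; apply: eq_bigr => j _.
  have [->|ji] := eqVneq j i; last by rewrite zx // !mxE; ring.
  by rewrite !mxE G1_diag G2_diag; ring.
rewrite !utilE ?mxE ?eqxx => [| j _| j /negPf ji]; rewrite ?mxE ?ji //.
by rewrite xT -/(T x i) /T -/s -(qE i); apply: best_response_max.
Qed.
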